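(* Consider the Euclidean space $\mathbb{R}^n$. Let $\Omega\subset\mathbb{R}^n$ be a nonempty compact set which is strongly convex with respect to $R>0$. Let $r>0$ be such that $\mathbb{S}^2_r\cap\Omega=\emptyset$. Suppose that there exists a constant $c_0>0$ such that $$\|p_1-p_2\|_2\ge c_0\|x_1-x_2\|_2\quad\text{for all }x_1,x_2\in\mathbb{S}^2_r,$$ where $p_i$ denotes the Euclidean projection of $x_i$ onto $\Omega$, $i=1,2$. Then there exists $\sigma>0$ (one may take $\sigma=c^2/R$ for some $0<c\le c_0$) such that for all $x_1,x_2\in\mathbb{S}^2_r$ and all $\lambda\in(0,1)$, $$d_\Omega\big((1-\lambda)x_1+\lambda x_2\big)\le\max\{d_\Omega(x_1),d_\Omega(x_2)\}-\frac{\sigma}{2}\lambda(1-\lambda)\|x_1-x_2\|_2^2.$$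
   Context: $\|\cdot\|_2$ is the Euclidean norm on $\mathbb{R}^n$, $\mathbb{B}^2[c;R]=\{x\in\mathbb{R}^n\mid\|x-c\|_2\le R\}$, and $\mathbb{S}^2_r=\{x\in\mathbb{R}^n\mid\|x\|_2=r\}$. The distance function is $d_\Omega(x)=\inf\{\|x-y\|_2\mid y\in\Omega\}$. Given $R>0$ and $x,y\in\mathbb{R}^n$ with $\|x-y\|_2\le 2R$, let $D_R(x,y)$ be the intersection of all closed Euclidean balls of radius $R$ (i.e. sets $\mathbb{B}^2[c;R]$, $c\in\mathbb{R}^n$) that contain both $x$ and $y$. A nonempty bounded set $\Omega\subset\mathbb{R}^n$ is strongly convex with respect to $R>0$ if $D_R(x,y)\subset\Omega$ for all $x,y\in\Omega$; this includes the requirement that $\|x-y\|_2\le 2R$ for all $x,y\in\Omega$, so that $D_R(x,y)$ is defined. A strongly convex set is convex, so for compact $\Omega$ the Euclidean projection of a point onto $\Omega$ (the nearest point of $\Omega$) exists and is unique. *)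

(* Defs.v *)
(* R^n is modelled by the row vectors 'rV[K]_n over a realType K. *)
From mathcomp Require Import all_boot all_order all_algebra.
From mathcomp Require Import all_classical all_reals all_analysis.

Set Implicit Arguments.
Unset Strict Implicit.
Unset Printing Implicit Defensive.

Import Order.TTheory GRing.Theory Num.Theory.
Import numFieldNormedType.Exports.

Local Open Scope classical_set_scope.
Local Open Scope ring_scope.

(* The library norm `|x| on 'rV[K]_n is the sup norm. Both norms induce the
   same topology, so the library's [compact] is the usual compactness. *)
Definition norm2 (K : realType) (n : nat) (x : 'rV[K]_n) : K :=
  Num.sqrt (\sum_(i < n) x ord0 i ^+ 2).

Definition cball2 (K : realType) (n : nat) (c : 'rV[K]_n) (R : K) :
    set 'rV[K]_n :=
  [set x | norm2 (x - c) <= R].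

Definition sphere2 (K : realType) (n : nat) (r : K) : set 'rV[K]_n :=
  [set x | norm2 x = r].

(* [inf] is real-valued, hence only meaningful for nonempty Omega. *)
Definition dist2 (K : realType) (n : nat) (Omega : set 'rV[K]_n)
    (x : 'rV[K]_n) : K :=
  inf [set norm2 (x - y) | y in Omega].

(* The set D_R(x, y). When norm2 (x - y) > 2R no ball qualifies and this is
   setT; [strongly_convex] excludes that case explicitly. *)
Definition ball_hull (K : realType) (n : nat) (R : K) (x y : 'rV[K]_n) :
    set 'rV[K]_n :=
  \bigcap_(c in [set c | cball2 c R x /\ cball2 c R y]) cball2 c R.

Definition bounded2 (K : realType) (n : nat) (Omega : set 'rV[K]_n) : Prop :=
  exists M : K, forall x, Omega x -> norm2 x <= M.

Definition strongly_convex (K : realType) (n : nat) (R : K)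
    (Omega : set 'rV[K]_n) : Prop :=
  [/\ Omega !=set0, bounded2 Omega &
      forall x y, Omega x -> Omega y ->
        norm2 (x - y) <= 2 * R /\ ball_hull R x y `<=` Omega].

(* p is a nearest point of Omega to x; it exists and is unique when Omega is
   nonempty, compact and convex. *)
Definition is_proj2 (K : realType) (n : nat) (Omega : set 'rV[K]_n)
    (x p : 'rV[K]_n) : Prop :=
  Omega p /\ forall q, Omega q -> norm2 (x - p) <= norm2 (x - q).

(* Main.v *)
(* Let z and q be the convex combinations with weight lambda of x1, x2 and of
   their projections p1, p2, so that |z - q| <= max d(x_i). By strong convexity
   Omega contains the ball around q of radius
   delta = lambda (1 - lambda) |p1 - p2|^2 / (2 R), and the lower bound on
   |p1 - p2| makes delta at least the required gain. If |z - q| > delta, moving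
   from q towards z by delta stays in Omega, whence d(z) <= |z - q| - delta.
   Otherwise z lies in Omega and d(z) = 0; then the gain must be at most
   max d(x_i), which holds for small c because Omega, being compact, is at
   positive distance from the sphere. *)
Require Import Defs.
From mathcomp Require Import all_boot all_order all_algebra.
From mathcomp Require Import all_classical all_reals all_analysis.
From mathcomp Require Import ring lra.
Import Order.TTheory GRing.Theory Num.Theory.
Import numFieldNormedType.Exports.
Local Open Scope classical_set_scope.
Local Open Scope ring_scope.

Lemma norm2_ge0 {K : realType} {n : nat} (x : 'rV[K]_n) : 0 <= norm2 x.
Proof. exact: sqrtr_ge0. Qed.

Lemma sqr_norm2 {K : realType} {n : nat} (x : 'rV[K]_n) :
  norm2 x ^+ 2 = \sum_(i < n) x ord0 i ^+ 2.
Proof. by rewrite sqr_sqrtr// sumr_ge0// => i _; exact: sqr_ge0. Qed.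

Lemma norm2Z {K : realType} {n : nat} (a : K) (x : 'rV[K]_n) :
  norm2 (a *: x) = `|a| * norm2 x.
Proof.
rewrite /norm2 -sqrtr_sqr -sqrtrM ?sqr_ge0// mulr_sumr.
by congr Num.sqrt; apply: eq_bigr => i _; rewrite mxE exprMn.
Qed.

Lemma norm2N {K : realType} {n : nat} (x : 'rV[K]_n) : norm2 (- x) = norm2 x.
Proof. by rewrite -scaleN1r norm2Z normrN1 mul1r. Qed.

Lemma norm2_distC {K : realType} {n : nat} (x y : 'rV[K]_n) :
  norm2 (x - y) = norm2 (y - x).
Proof. by rewrite -norm2N opprB. Qed.

(** The quadratic form |s x - t y|^2 is nonnegative; at s = |y|, t = |x| it equals 2 |x| |y| (|x|
    |y| - d), which settles the case |x| |y| > 0. *)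
Lemma cauchy_schwarz2 {K : realType} {n : nat} (x y : 'rV[K]_n) :
  \sum_(i < n) x ord0 i * y ord0 i <= norm2 x * norm2 y.
Proof.
set d := \sum_(i < n) _; set a := norm2 x; set b := norm2 y.
have a0 : 0 <= a by exact: norm2_ge0.
have b0 : 0 <= b by exact: norm2_ge0.
have expand s t : \sum_(i < n) (s * x ord0 i - t * y ord0 i) ^+ 2 =
    s ^+ 2 * a ^+ 2 - 2 * s * t * d + t ^+ 2 * b ^+ 2.
  rewrite !sqr_norm2 /d !mulr_sumr -sumrB -big_split /=.
  by apply: eq_bigr => i _; ring.
have nonneg s t : 0 <= s ^+ 2 * a ^+ 2 - 2 * s * t * d + t ^+ 2 * b ^+ 2.
  by rewrite -expand sumr_ge0// => i _; exact: sqr_ge0.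
have [ab0|ab0] := ltP 0 (a * b).
  have := nonneg b a.
  have -> : b ^+ 2 * a ^+ 2 - 2 * b * a * d + a ^+ 2 * b ^+ 2 =
    2 * (a * b) * (a * b - d) by ring.
  by rewrite pmulr_rge0 ?subr_ge0// mulr_gt0.
have /eqP : a * b = 0 by apply/eqP; rewrite eq_le ab0 mulr_ge0.
rewrite leNgt mulf_eq0 => /orP ab_eq0; apply/negP => d_gt.
have d0 : 0 < d by apply: le_lt_trans d_gt; exact: mulr_ge0.
case: ab_eq0 => /eqP e0.
  (* With a = 0 the form is affine in s, of slope - 2 d < 0 at t = 1; this s is large enough to make
     it negative. The case b = 0 is symmetric. *)
  have := nonneg ((b ^+ 2 + 1) / d) 1; rewrite e0.
  have -> : ((b ^+ 2 + 1) / d) ^+ 2 * 0 ^+ 2 - 2 * ((b ^+ 2 + 1) / d) * 1 * d +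
    1 ^+ 2 * b ^+ 2 = - b ^+ 2 - 2 by field; rewrite gt_eqF.
  by have := sqr_ge0 b; lra.
have := nonneg 1 ((a ^+ 2 + 1) / d); rewrite e0.
have -> : 1 ^+ 2 * a ^+ 2 - 2 * 1 * ((a ^+ 2 + 1) / d) * d +
  ((a ^+ 2 + 1) / d) ^+ 2 * 0 ^+ 2 = - a ^+ 2 - 2 by field; rewrite gt_eqF.
by have := sqr_ge0 a; lra.
Qed.

Lemma ler_norm2D {K : realType} {n : nat} (x y : 'rV[K]_n) :
  norm2 (x + y) <= norm2 x + norm2 y.
Proof.
rewrite -(@ler_pXn2r _ 2)// ?nnegrE ?addr_ge0 ?norm2_ge0//.
have -> : norm2 (x + y) ^+ 2 = norm2 x ^+ 2 +
    2 * \sum_(i < n) x ord0 i * y ord0 i + norm2 y ^+ 2.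
  rewrite !sqr_norm2 mulr_sumr -!big_split /=.
  by apply: eq_bigr => i _; rewrite mxE; ring.
by have := cauchy_schwarz2 x y; rewrite sqrrD -mulr_natl; lra.
Qed.

(** Stewart's identity. The subtracted term is the source of the quadratic gain in t (1 - t). *)
Lemma sqr_norm2_conv {K : realType} {n : nat} (x y : 'rV[K]_n) (t : K) :
  norm2 ((1 - t) *: x + t *: y) ^+ 2 =
  (1 - t) * norm2 x ^+ 2 + t * norm2 y ^+ 2
  - t * (1 - t) * norm2 (x - y) ^+ 2.
Proof.
rewrite !sqr_norm2 !mulr_sumr -big_split -sumrB /=.
by apply: eq_bigr => i _; rewrite !mxE; ring.
Qed.

(** The topology is that of the sup norm, so continuity is obtained coordinate by coordinate. *)
Lemma norm2_dist_continuous {K : realType} {n : nat} (x : 'rV[K]_n) :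
  continuous (fun y : 'rV[K]_n => norm2 (x - y)).
Proof.
move=> y; apply: (@continuous_comp _ _ _
  (fun y : 'rV[K]_n => \sum_(i < n) (x - y) ord0 i ^+ 2) Num.sqrt); last first.
  exact: sqrt_continuous.
apply: (@continuous_big K) => [|i _ {}y]; first exact: add_continuous.
have yi : {for y, continuous (fun y : 'rV[K]_n => x ord0 i - y ord0 i)}.
  apply: (@continuousB _ K^o); first exact: cst_continuous.
  exact: coord_continuous.
under [fun y => _]eq_fun do rewrite !mxE expr2.
exact: (@continuousM K _ _ _ _ yi yi).
Qed.

Lemma proj2_exists {K : realType} {n : nat} (A : set 'rV[K]_n) (x : 'rV[K]_n) :
  A !=set0 -> compact A -> exists p, is_proj2 A x p.
Proof.
move=> A0 cA.
have [|p pA pmin] := @EVT_min_rV _ _ (fun y => norm2 (x - y)) A A0 cA.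
  by apply: continuous_subspaceT; exact: norm2_dist_continuous.
exists p; split; first exact: set_mem.
by move=> q Aq; apply: pmin; exact: mem_set.
Qed.

Lemma dist2_le {K : realType} {n : nat} (A : set 'rV[K]_n) (x y : 'rV[K]_n) :
  A y -> dist2 A x <= norm2 (x - y).
Proof.
move=> Ay; apply: ge_inf; last by exists y.
by exists 0 => _ [z _ <-]; exact: norm2_ge0.
Qed.

Lemma dist2_proj {K : realType} {n : nat} (A : set 'rV[K]_n)
    (x p : 'rV[K]_n) :
  is_proj2 A x p -> dist2 A x = norm2 (x - p).
Proof.
move=> [Ap pmin]; apply/eqP; rewrite eq_le dist2_le//=.
by apply: lb_le_inf; [exists (norm2 (x - p)), p|move=> _ [q Aq <-]; exact: pmin].
Qed.

(* With q the centre and del the radius of the small ball, |x - c|, |y - c| <= R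
   give |q - c|^2 <= R^2 - 2 R del <= (R - del)^2. *)
Lemma cball2_sub_hull {K : realType} {n : nat} (R t : K) (x y : 'rV[K]_n) :
  0 < R -> 0 <= t <= 1 -> norm2 (x - y) <= 2 * R ->
  cball2 ((1 - t) *: x + t *: y)
    (t * (1 - t) * norm2 (x - y) ^+ 2 / (2 * R)) `<=` ball_hull R x y.
Proof.
move=> R0 /andP[t0 t1] xyR w; rewrite /cball2 /=.
set q := (1 - t) *: x + t *: y; set del := _ / (2 * R) => wq c [] /=.
rewrite /cball2 /= => xc yc.
have e : t * (1 - t) * norm2 (x - y) ^+ 2 = 2 * R * del.
  by rewrite /del [RHS]mulrC divfK// gt_eqF// mulr_gt0.
have xy0 := norm2_ge0 (x - y).
have xy2 : norm2 (x - y) ^+ 2 <= (2 * R) ^+ 2.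
  by rewrite ler_pXn2r// nnegrE// ltW// mulr_gt0.
have tt : t * (1 - t) <= 1 / 4 by have := sqr_ge0 (t - 1 / 2); lra.
(* This makes R - del nonnegative, so that [qc] may be proved by comparing squares. *)
have delR : del <= R.
  have R2 : 0 < 2 * R by rewrite mulr_gt0.
  rewrite -(ler_pM2l R2) -e.
  have /le_trans : t * (1 - t) * norm2 (x - y) ^+ 2 <= 1 / 4 * (2 * R) ^+ 2.
    by rewrite ler_pM ?sqr_ge0// mulr_ge0 ?subr_ge0.
  by apply; have := sqr_ge0 R; lra.
have qc : norm2 (q - c) <= R - del.
  rewrite -(@ler_pXn2r _ 2)// ?nnegrE ?subr_ge0 ?norm2_ge0//.
  have -> : q - c = (1 - t) *: (x - c) + t *: (y - c).
    by apply/rowP => i; rewrite !mxE; ring.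
  rewrite sqr_norm2_conv.
  have -> : x - c - (y - c) = x - y by apply/rowP => i; rewrite !mxE; ring.
  rewrite e.
  have xc2 : norm2 (x - c) ^+ 2 <= R ^+ 2.
    by rewrite ler_pXn2r// nnegrE ?norm2_ge0// ltW.
  have yc2 : norm2 (y - c) ^+ 2 <= R ^+ 2.
    by rewrite ler_pXn2r// nnegrE ?norm2_ge0// ltW.
  by have := sqr_ge0 del; nra.
have -> : w - c = (w - q) + (q - c) by rewrite addrA subrK.
by apply: le_trans (ler_norm2D _ _) _; lra.
Qed.

(** On the compact set A the function |r - |y|| attains its minimum, which is positive by
    disjointness and bounds the distance to the sphere from below. *)
Lemma sphere2_dist_ge {K : realType} {n : nat} (A : set 'rV[K]_n) (r : K) :
  A !=set0 -> compact A -> sphere2 r `&` A = set0 ->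
  exists2 d : K, 0 < d & forall x, sphere2 r x -> d <= dist2 A x.
Proof.
move=> A0 cA rA.
(* Writing |y| as [norm2 (0 - y)] lets [norm2_dist_continuous] apply. *)
have [|m mA mmin] := @EVT_min_rV _ _ (fun y => `|r - norm2 (0 - y)|) A A0 cA.
  apply: continuous_subspaceT => y.
  apply: (@continuous_comp _ _ _ (fun y : 'rV[K]_n => r - norm2 (0 - y))
    Num.norm); last exact: norm_continuous.
  apply: (@continuousB _ K^o); [exact: cst_continuous|].
  exact: norm2_dist_continuous.
exists `|r - norm2 (0 - m)|.
  rewrite normr_gt0 subr_eq0; apply/eqP => rm.
  suff : set0 m by [].
  by rewrite -rA; split; [rewrite /sphere2 /= rm sub0r norm2N|exact: set_mem].
move=> x xr; have [p xp] := proj2_exists A x A0 cA.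
rewrite (dist2_proj _ _ _ xp); apply: le_trans (mmin p _) _.
  by apply: mem_set; case: xp.
(* With r = |x| this is the reverse triangle inequality for x and p. *)
rewrite sub0r norm2N -xr ler_norml.
have := ler_norm2D (x - p) p; have := ler_norm2D (p - x) x.
by rewrite !subrK (norm2_distC p x); lra.
Qed.

Theorem theorem3p9 (K : realType) (n : nat) (Omega : set 'rV[K]_n)
    (R r c0 : K)
    (Omega_nonempty : Omega !=set0)
    (Omega_compact : compact Omega)
    (R_gt0 : 0 < R)
    (Omega_sconvex : strongly_convex R Omega)
    (r_gt0 : 0 < r)
    (sphere_disjoint : @sphere2 K n r `&` Omega = set0)
    (c0_gt0 : 0 < c0)
    (proj_expand : forall x1 x2 p1 p2 : 'rV[K]_n,
        sphere2 r x1 -> sphere2 r x2 ->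
        is_proj2 Omega x1 p1 -> is_proj2 Omega x2 p2 ->
        c0 * norm2 (x1 - x2) <= norm2 (p1 - p2)) :
  exists sigma : K,
    [/\ 0 < sigma,
        exists c : K, [/\ 0 < c, c <= c0 & sigma = c ^+ 2 / R] &
        forall (x1 x2 : 'rV[K]_n) (lambda : K),
          sphere2 r x1 -> sphere2 r x2 -> 0 < lambda < 1 ->
          dist2 Omega ((1 - lambda) *: x1 + lambda *: x2) <=
            Num.max (dist2 Omega x1) (dist2 Omega x2)
            - sigma / 2 * lambda * (1 - lambda) * norm2 (x1 - x2) ^+ 2].
Proof.
have [d d0 dle] :=
  sphere2_dist_ge _ _ Omega_nonempty Omega_compact sphere_disjoint.
have [_ _ hull] := Omega_sconvex.
have s0 : 0 < 2 * R * d / r ^+ 2.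
  by rewrite divr_gt0 ?exprn_gt0// !mulr_gt0.
(* The second argument of the minimum is the value of c at which c^2 r^2 / (2 R), a bound on every
   gain, equals d. *)
pose c := Num.min c0 (Num.sqrt (2 * R * d / r ^+ 2)).
have c_gt0 : 0 < c by rewrite lt_min c0_gt0 sqrtr_gt0.
have c_le : c <= c0 by rewrite ge_min lexx.
have c2r : c ^+ 2 / R / 2 * r ^+ 2 <= d.
  have : c ^+ 2 <= 2 * R * d / r ^+ 2.
    rewrite -[leRHS]sqr_sqrtr; last exact: ltW.
    by rewrite ler_pXn2r ?nnegrE ?sqrtr_ge0 ?(ltW c_gt0)// ge_min lexx orbT.
  rewrite ler_pdivlMr ?exprn_gt0// => h.
  have -> : c ^+ 2 / R / 2 * r ^+ 2 = c ^+ 2 * r ^+ 2 / (2 * R).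
    by field; rewrite gt_eqF.
  by rewrite ler_pdivrMr ?mulr_gt0//; lra.
exists (c ^+ 2 / R); split; [by rewrite divr_gt0 ?exprn_gt0|by exists c|].
move=> x1 x2 t x1r x2r /andP[t0 t1].
have [p1 xp1] := proj2_exists _ x1 Omega_nonempty Omega_compact.
have [p2 xp2] := proj2_exists _ x2 Omega_nonempty Omega_compact.
set z := (1 - t) *: x1 + t *: x2; pose q := (1 - t) *: p1 + t *: p2.
set M := Num.max _ _.
have M1 : norm2 (x1 - p1) <= M by rewrite -(dist2_proj _ _ _ xp1) le_max lexx.
have M2 : norm2 (x2 - p2) <= M by rewrite -(dist2_proj _ _ _ xp2) le_max lexx orbT.
have dM : d <= M by apply: le_trans (dle _ x1r) _; rewrite le_max lexx.
have tt0 : 0 < t * (1 - t) by rewrite mulr_gt0 ?subr_gt0.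
have zq : norm2 (z - q) <= M.
  have -> : z - q = (1 - t) *: (x1 - p1) + t *: (x2 - p2).
    by apply/rowP => i; rewrite !mxE; ring.
  apply: le_trans (ler_norm2D _ _) _.
  by rewrite !norm2Z !ger0_norm; nra.
have [Op1 _] := xp1; have [Op2 _] := xp2.
have [p12 hullO] := hull _ _ Op1 Op2.
pose del := t * (1 - t) * norm2 (p1 - p2) ^+ 2 / (2 * R).
have ball_sub : cball2 q del `<=` Omega.
  apply: subset_trans hullO; apply: cball2_sub_hull => //.
  by rewrite !ltW.
have del_ge : c ^+ 2 / R / 2 * t * (1 - t) * norm2 (x1 - x2) ^+ 2 <= del.
  have cx : c * norm2 (x1 - x2) <= norm2 (p1 - p2).
    apply: le_trans (proj_expand _ _ _ _ x1r x2r xp1 xp2).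
    by rewrite ler_wpM2r ?norm2_ge0.
  have -> : c ^+ 2 / R / 2 * t * (1 - t) * norm2 (x1 - x2) ^+ 2 =
      t * (1 - t) * (c * norm2 (x1 - x2)) ^+ 2 / (2 * R).
    by field; rewrite gt_eqF.
  rewrite ler_pM2r ?invr_gt0 ?mulr_gt0// ler_pM2l//.
  by rewrite ler_pXn2r ?nnegrE ?norm2_ge0// mulr_ge0 ?norm2_ge0 ?ltW.
have [zdel|zdel] := leP (norm2 (z - q)) del.
  have Oz : Omega z by apply: ball_sub.
  have z0 : dist2 Omega z <= 0.
    apply: le_trans (dist2_le _ z _ Oz) _.
    by rewrite subrr -(scale0r z) norm2Z normr0 mul0r.
  (* The right-hand side is nonnegative by the chain gain <= c^2 r^2 / (2 R) <= d <= M. *)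
  apply: le_trans z0 _; rewrite subr_ge0; apply: le_trans dM; apply: le_trans c2r.
  have -> : c ^+ 2 / R / 2 * t * (1 - t) * norm2 (x1 - x2) ^+ 2 =
    c ^+ 2 / R / 2 * (t * (1 - t) * norm2 (x1 - x2) ^+ 2) by ring.
  rewrite ler_pM2l ?divr_gt0 ?exprn_gt0//.
  (* t (1 - t) |x1 - x2|^2 = r^2 - |z|^2 as x1, x2 lie on the sphere *)
  have := sqr_norm2_conv x1 x2 t; rewrite x1r x2r.
  by have := sqr_ge0 (norm2 ((1 - t) *: x1 + t *: x2)); lra.
have del0 : 0 <= del.
  by rewrite divr_ge0 ?(mulr_ge0 (ltW tt0)) ?sqr_ge0 ?mulr_ge0 ?ltW.
have zq0 : 0 < norm2 (z - q) by exact: le_lt_trans zdel.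
(* The point of the segment from q to z at distance del from q: it lies in the ball, and |z - y| =
   |z - q| - del. *)
pose y := q + (del / norm2 (z - q)) *: (z - q).
have Oy : Omega y.
  apply: ball_sub; rewrite /cball2 /= /y addrC addKr norm2Z.
  rewrite ger0_norm; last exact: divr_ge0 del0 (ltW zq0).
  by rewrite divfK // gt_eqF.
apply: le_trans (dist2_le _ z _ Oy) _.
have -> : z - y = (1 - del / norm2 (z - q)) *: (z - q).
  by rewrite /y scalerBl scale1r opprD addrA.
rewrite norm2Z ger0_norm; last by rewrite subr_ge0 ler_pdivrMr// mul1r ltW.
by rewrite mulrBl mul1r divfK ?gt_eqF//; lra.
Qed.
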